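(* Let $T$ be an operator semigroup on a set $D$, let $S$ be a $T$-space and let $B\subseteq S$. Let $\mathcal{T}_2$ be the topology on $S$ generated by the subbasis $\beta_2=\{S\setminus A: A\in\operatorname{Int}_T^{\operatorname{Aut}}(S/B)\}\cup\{S\}$. Let $P_2$ be the set of all topologies on $S$ for which $$\operatorname{Int}_T^{\operatorname{Aut}}(S/B)\setminus\{\emptyset\}=\{S': B\subseteq S'\le_q S,\ S'\text{ is closed and nonempty}\}, \qquad ( * )$$ and let $Q_2$ be the set of all topologies on $S$ which are finer than (i.e. contain) $\mathcal{T}_2$. Then $P_2\subseteq Q_2$ and the following statements are equivalent: (i) $P_2\neq\emptyset$. (ii) For all $S_1,S_2\in\operatorname{Int}_T^{\operatorname{Aut}}(S/B)$, $S_1\cup S_2\in\operatorname{Int}_T^{\operatorname{Aut}}(S/B)$. (Or equivalently, $\beta_2$ is a basis for $\mathcal{T}_2$.) (iii) $\operatorname{Int}_T^{\operatorname{Aut}}(S/B)$ is a $\vee$-sublattice of the lattice $\operatorname{Sub}_T(S)$. (iv) $\mathcal{T}_2\in P_2$ (where $P_2\subseteq Q_2$); that is, $\mathcal{T}_2$ is the coarsest topology on $S$ such that $( * )$ is satisfied.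
   Context: An operator semigroup on a set $D$ is a (possibly empty) set $T$ of functions $D\to D$ closed under composition. For $U\subseteq D$ put $\langle U\rangle_T=\{f(u): f\in T,\ u\in U\}$; a $T$-space is a subset of $D$ of the form $\langle U\rangle_T$. A subset $S\subseteq D$ is a quasi-$T$-space if $\langle S\rangle_T\subseteq S$; every $T$-space is a quasi-$T$-space. If $S'\subseteq S$ are both quasi-$T$-spaces, we write $S'\le_q S$ and call $S'$ a quasi-$T$-subspace of $S$. $\operatorname{Sub}_T(S)$ is the set of all quasi-$T$-subspaces of $S$, a lattice under inclusion with $S_1\wedge S_2=S_1\cap S_2$ and $S_1\vee S_2=S_1\cup S_2$. A $T$-morphism from a $T$-space $S$ to a $T$-space is a map $\sigma$ with $\sigma(f(a))=f(\sigma(a))$ for all $a\in S$, $f\in T$; $\operatorname{Aut}_T(S)$ is the set of bijective $T$-morphisms from $S$ to itself. For $H\subseteq\operatorname{Aut}_T(S)$, $S^H=\{a\in S:\sigma(a)=a\ \forall\sigma\in H\}$, and $\operatorname{Int}_T^{\operatorname{Aut}}(S/B)=\{S^H: H\subseteq\operatorname{Aut}_T(S),\ B\subseteq S^H\}$ (a subset of $\operatorname{Sub}_T(S)$). A $\vee$-sublattice is a subset closed under binary joins of the ambient lattice. The topology generated by a subbasis is the collection of all unions of finite intersections of its members. *)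

(* Defs.v *)
From HB Require Import structures.
From mathcomp Require Import all_boot all_order finmap.
From mathcomp Require Import boolp classical_sets functions filter.
From mathcomp Require Import topology_structure.

Set Implicit Arguments.
Unset Strict Implicit.
Unset Printing Implicit Defensive.

Local Open Scope classical_set_scope.

Section OperatorSemigroup.
Variables (D : Type) (T : set (D -> D)).
Implicit Types (U S B A : set D) (sigma : D -> D) (H : set (D -> D)).

Definition operator_semigroup := forall f g, T f -> T g -> T (f \o g).

Definition Tgen U : set D := [set f u | f in T & u in U].

Definition Tspace S := exists U, S = Tgen U.

Definition quasi_Tspace S := Tgen S `<=` S.

Definition quasi_Tsubspace A S :=
  [/\ quasi_Tspace A, quasi_Tspace S & A `<=` S].

(* A map S -> S' between subsets of D is a function D -> D sending S into S';
   several functions represent the same map, but nothing below depends on their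
   values outside S. *)
Definition Tmorphism S S' sigma :=
  set_fun S S' sigma /\ forall f a, T f -> S a -> sigma (f a) = f (sigma a).

Definition AutT S : set (D -> D) :=
  [set sigma | Tmorphism S S sigma /\ set_bij S S sigma].

Definition fixset S H : set D :=
  [set a | S a /\ forall sigma, H sigma -> sigma a = a].

Definition IntAut S B : set (set D) :=
  [set fixset S H | H in [set H | H `<=` AutT S /\ B `<=` fixset S H]].

End OperatorSemigroup.

(* Sub_T(S), as a sublattice of the powerset lattice of D. *)
Section SubLattice.
Variables (D : Type) (T : set (D -> D)) (S : set D).

Definition Sub_pred : {pred set D} := fun A => `[< quasi_Tsubspace T A S >].

Lemma Sub_predI : {in Sub_pred &, forall A B, (A `&` B)%O \in Sub_pred}.
Proof.
move=> A B /asboolP[qA qS AS] /asboolP[qB _ _]; apply/asboolP; split => //.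
  move=> _ [f Tf [u [Au Bu] <-]]; split.
    by apply: qA; exists f => //; exists u.
  by apply: qB; exists f => //; exists u.
by move=> x [/AS].
Qed.

Lemma Sub_predU : {in Sub_pred &, forall A B, (A `|` B)%O \in Sub_pred}.
Proof.
move=> A B /asboolP[qA qS AS] /asboolP[qB _ BS]; apply/asboolP; split => //.
  move=> _ [f Tf [u [Au|Bu] <-]].
    by left; apply: qA; exists f => //; exists u.
  by right; apply: qB; exists f => //; exists u.
by move=> x [/AS|/BS].
Qed.

HB.instance Definition _ :=
  Order.isLatticeClosed.Build _ _ Sub_pred Sub_predI Sub_predU.

Record SubT := MkSubT { SubT_val :> set D ; _ : SubT_val \in Sub_pred }.

HB.instance Definition _ := [isSub for SubT_val].
HB.instance Definition _ := [Choice of SubT by <:].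
HB.instance Definition _ :=
  [SubChoice_isSubLattice of SubT by <: with set_display].

End SubLattice.

Lemma SubT_leE (D : Type) (T : set (D -> D)) (S : set D) (A B : SubT T S) :
  (A <= B)%O = `[< (A : set D) `<=` B >].
Proof. by []. Qed.

Lemma SubT_joinE (D : Type) (T : set (D -> D)) (S : set D) (A B : SubT T S) :
  SubT_val (A `|` B)%O = SubT_val A `|` SubT_val B.
Proof. by []. Qed.

Lemma SubT_meetE (D : Type) (T : set (D -> D)) (S : set D) (A B : SubT T S) :
  SubT_val (A `&` B)%O = SubT_val A `&` SubT_val B.
Proof. by []. Qed.

Definition join_sublattice d (L : latticeType d) (X : set L) :=
  forall x y, X x -> X y -> X (x `|` y)%O.

Lemma Tspace_quasi (D : Type) (T : set (D -> D)) (S : set D) :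
  operator_semigroup T -> Tspace T S -> quasi_Tspace T S.
Proof.
move=> sgT [U ->] _ [f Tf [_ [g Tg [u Uu <-]] <-]].
by exists (f \o g); [exact: sgT|exists u].
Qed.

Lemma IntAut_sub (D : Type) (T : set (D -> D)) (S B : set D) :
  operator_semigroup T -> Tspace T S ->
  IntAut T S B `<=` (fun A => quasi_Tsubspace T A S).
Proof.
move=> sgT TS; have qS := Tspace_quasi sgT TS.
move=> _ [H [HA _] <-]; split=> //; last by move=> a [].
move=> _ [f Tf [a [Sa fixa] <-]]; split.
  by apply: qS; exists f => //; exists a.
move=> s Hs; have [[_ mor] _] := HA _ Hs.
by rewrite mor // fixa.
Qed.

Definition Int_in_Sub (D : Type) (T : set (D -> D)) (S B : set D) :
  set (SubT T S) := [set A | IntAut T S B A].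

(* The topologies on a type X are the structures of topologicalType on X. *)
Definition topology (X : Type) : Type := Topological.axioms_ X.

Section TopologyNotions.
Variables (X : Type) (t : topology X).

Definition opens : set (set X) := @open (Topological.Pack t).
Definition is_closed (A : set X) : Prop := @closed (Topological.Pack t) A.
Definition is_basis (b : set (set X)) : Prop := @basis (Topological.Pack t) b.

End TopologyNotions.

(* Every family satisfying the open-set axioms is the family of open sets of
   such a structure. *)
Section TopologyOfOpens.
Variables (X : Type) (O : set (set X)).
Hypotheses (OT : O setT) (OI : setI_closed O).
Hypothesis OU : forall (I : Type) (f : I -> set X),
  (forall i, O (f i)) -> O (\bigcup_i f i).

Let Y : Type := X.
HB.instance Definition _ := gen_eqMixin Y.
HB.instance Definition _ := gen_choiceMixin Y.
HB.instance Definition _ := @isOpenTopological.Build Y O OT OI OU.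

Lemma topology_of_opens : exists t : topology X, opens t = O.
Proof. by exists (Topological.class Y). Qed.

End TopologyOfOpens.

Definition finer (X : Type) (t1 t2 : topology X) : Prop :=
  opens t2 `<=` opens t1.

(* Topologies on S live on the subtype S; the trace on S of a set A of elements
   of D is [val @^-1` A]. *)
Section FixTopologies.
Variables (D : Type) (T : set (D -> D)) (S B : set D).

Definition beta2 : set (set S) :=
  [set val @^-1` (S `\` A) | A in IntAut T S B] `|` [set val @^-1` S].

(* An alias of the subtype S carrying the topology with subbasis beta2. *)
Definition tau2_space : Type := S.
HB.instance Definition _ := gen_eqMixin tau2_space.
HB.instance Definition _ := gen_choiceMixin tau2_space.
HB.instance Definition _ :=
  isSubBaseTopological.Build tau2_space (beta2 : set (set tau2_space)) id.

Definition tau2 : topology S := Topological.class tau2_space.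

Lemma opens_tau2 : opens tau2 =
  [set \bigcup_(U in F) U | F in [set F | F `<=` finI_from beta2 id]].
Proof. by []. Qed.

Definition P2 : set (topology S) :=
  [set t | IntAut T S B `\ set0 =
    [set S' | [/\ B `<=` S', quasi_Tsubspace T S' S,
                  is_closed t (val @^-1` S') & S' !=set0]]].

Definition Q2 : set (topology S) := [set t | finer t tau2].

End FixTopologies.

Arguments IntAut {D} T S B.
Arguments Int_in_Sub {D} T S B.
Arguments beta2 {D} T S B.
Arguments tau2 {D} T S B.
Arguments P2 {D} T S B.
Arguments Q2 {D} T S B.

(* Main.v *)
Require Import Defs.
From mathcomp Require Import all_boot all_order.
From mathcomp Require Import boolp classical_sets functions topology_structure.
From mathcomp Require Import filter.

(** Int(S/B) consists of the sets containing B that are closed for the Galois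
    connection between subsets of S and sets of automorphisms, so it is stable
    under arbitrary intersections: a set between B and S belongs to it as soon
    as each outside point is separated from it by a member
    ([IntAut_separated]). Its members are quasi-T-subspaces because
    automorphisms commute with T. Stability under binary unions is then exactly
    what it lacks in order to be, up to the empty set, the family of closed sets
    of a topology, and all of (i)-(iv) express this.

    - A topology in P2 has all members of Int(S/B) as closed sets (the empty one
      being closed anyway), so its open sets contain beta2: hence P2 is included
      in Q2 ([P2_sub_Q2]), which also makes tau2 the coarsest element of P2
      whenever it is an element. Since a union of two closed sets is closed, such
      a topology forces Int(S/B) to be stable under unions ([P2_IntAutU]).
    - If Int(S/B) is stable under unions, then beta2 is stable under finite
      intersections, hence a basis ([IntAutU_basis]).
    - If beta2 is a basis, the complement of a nonempty closed set S' containing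
      B is covered by basic sets S \ A disjoint from S', i.e. S' is separated
      from each outside point by a member of Int(S/B), and thus is one itself
      ([basis_closed_IntAut]). So tau2 belongs to P2 ([basis_P2]), and in
      particular Int(S/B) is stable under unions.

    The lattice formulation (iii) only differs from (ii) by bundling members of
    Int(S/B) as elements of Sub_T(S). *)

Set Implicit Arguments.
Unset Strict Implicit.
Unset Printing Implicit Defensive.

Local Open Scope classical_set_scope.

(** * Topologies given by their structure *)

Section TopologyStructures.
Variables (X : Type) (t : topology X).
Implicit Types (A O : set X) (b : set (set X)).

Lemma is_closedE A : is_closed t A = opens t (~` A).
Proof. exact: esym (@openC (Topological.Pack t) A). Qed.

Lemma is_closedU A1 A2 :
  is_closed t A1 -> is_closed t A2 -> is_closed t (A1 `|` A2).
Proof. exact: (@closedU (Topological.Pack t)). Qed.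

Lemma is_basis_open b O x :
  is_basis t b -> opens t O -> O x -> exists U, [/\ b U, U x & U `<=` O].
Proof.
move=> [_ /(_ x) bx] oO Ox.
have nO : @nbhs _ (Topological.Pack t) x O by exact: open_nbhs_nbhs.
by have [U [bU Ux] UO] := bx _ nO; exists U.
Qed.

Lemma is_basisP b : b `<=` opens t ->
  (forall O x, opens t O -> O x -> exists U, [/\ b U, U x & U `<=` O]) ->
  is_basis t b.
Proof.
move=> bo bO; split=> // x V.
move=> nV; have : @nbhs _ (Topological.Pack t) x V by exact: nV.
rewrite nbhsE => -[O [oO Ox] OV]; have [U [bU Ux UO]] := bO _ _ oO Ox.
by exists U => //; exact: subset_trans OV.
Qed.

Lemma opens_finI_from (I : choiceType) (D : set I) (f : I -> set X) :
  (forall i, D i -> opens t (f i)) -> finI_from D f `<=` opens t.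
Proof.
move=> fo _ [E ED <-]; rewrite bigcap_fset big_seq.
elim/big_ind: _ => [|A1 A2|i /ED /set_mem /fo //].
- exact: (@openT (Topological.Pack t)).
- exact: (@openI (Topological.Pack t)).
Qed.

Lemma opens_bigcup (I : Type) (D : set I) (f : I -> set X) :
  (forall i, D i -> opens t (f i)) -> opens t (\bigcup_(i in D) f i).
Proof. exact: (@bigcup_open (Topological.Pack t)). Qed.

End TopologyStructures.

Section IntAutTopologies.
Variables (D : Type) (T : set (D -> D)) (S B : set D).
Implicit Types (A : set D) (U : set S) (t : topology S).

(** * The Galois closed sets *)

(** The automorphisms fixing S' pointwise include every H whose fixed set
    contains S', so a point that they all fix lies in each member of the
    family containing S'. *)
Lemma IntAut_separated S' : B `<=` S' -> S' `<=` S ->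
    (forall x, S x -> ~ S' x ->
       exists A, [/\ IntAut T S B A, S' `<=` A & ~ A x]) ->
  IntAut T S B S'.
Proof.
move=> BS' S'S sep.
pose H := [set s | AutT T S s /\ forall a, S' a -> s a = a].
have S'H : S' `<=` Defs.fixset S H.
  by move=> a S'a; split; [exact: S'S | move=> s [_]; exact].
exists H; first by split; [move=> s [] | exact: subset_trans S'H].
apply/seteqP; split=> // x [Sx fixx]; apply: contrapT => S'x.
have [_ [[H' [H'Aut _] <-] S'A]] := sep x Sx S'x; apply; split=> // s H's.
by apply: fixx; split=> [|a /S'A[_]]; [exact: H'Aut | exact].
Qed.

Lemma IntAut_between A : IntAut T S B A -> B `<=` A /\ A `<=` S.
Proof. by move=> [H [_ BH] <-]; split=> // a []. Qed.

Lemma IntAutU_lattice : operator_semigroup T -> Tspace T S ->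
  (forall S1 S2, IntAut T S B S1 -> IntAut T S B S2 ->
     IntAut T S B (S1 `|` S2)) <->
  join_sublattice (Int_in_Sub T S B).
Proof.
move=> sgT TS; split=> [IU x y Ix Iy|IU S1 S2 I1 I2]; first exact: IU Ix Iy.
have sub A (IA : IntAut T S B A) : A \in Sub_pred T S.
  by apply/asboolP; exact: IntAut_sub IA.
exact: (IU (MkSubT (sub _ I1)) (MkSubT (sub _ I2))).
Qed.

(** * The subbasis beta2 *)

Lemma preimage_val_setD A : val @^-1` (S `\` A) = ~` (val @^-1` A) :> set S.
Proof.
by apply/seteqP; split=> [x [] // | x nAx]; split=> //; exact: set_valP.
Qed.

Lemma preimage_val_full : val @^-1` S = [set: S].
Proof. by apply/seteqP; split=> // x _; exact: set_valP. Qed.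

Lemma beta2_setT : beta2 T S B setT.
Proof. by right; rewrite -preimage_val_full. Qed.

Lemma beta2_setC A : IntAut T S B A -> beta2 T S B (~` (val @^-1` A)).
Proof. by move=> IA; left; exists A; rewrite ?preimage_val_setD. Qed.

Lemma beta2P U : beta2 T S B U ->
  U = setT \/ exists2 A, IntAut T S B A & U = ~` (val @^-1` A).
Proof.
move=> [[A IA <-]| ->]; last by left; exact: preimage_val_full.
by right; exists A; rewrite ?preimage_val_setD.
Qed.

Lemma beta2_tau2 : beta2 T S B `<=` opens (tau2 T S B).
Proof.
move=> U bU; rewrite opens_tau2; exists [set U]; last exact: bigcup_set1.
by move=> _ ->; exact: (@finI_from1 _ _ _ id).
Qed.

(** Since tau2 is generated by the complements of the members of Int(S/B), it
    is the coarsest topology in which they are all closed. *)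
Lemma closed_IntAut_finer t :
  (forall A, IntAut T S B A -> is_closed t (val @^-1` A)) ->
  finer t (tau2 T S B).
Proof.
move=> clA O; rewrite opens_tau2 => -[F Fb <-].
apply: opens_bigcup => V /Fb; apply: opens_finI_from => {V}U /beta2P[->|].
  exact: (@openT (Topological.Pack t)).
by move=> [A IA ->]; rewrite -is_closedE; exact: clA.
Qed.

(** De Morgan turns unions of members into intersections of subbasic sets. *)
Lemma IntAutU_basis :
    (forall S1 S2, IntAut T S B S1 -> IntAut T S B S2 ->
       IntAut T S B (S1 `|` S2)) ->
  is_basis (tau2 T S B) (beta2 T S B).
Proof.
move=> IU; apply: is_basisP => [|O x]; first exact: beta2_tau2.
rewrite opens_tau2 => -[F Fb <-] [U FU Ux].
exists U; split=> //; last exact: bigcup_sup.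
have [E Eb <-] := Fb _ FU; rewrite bigcap_fset big_seq.
elim/big_ind: _ => [|U1 U2|V /Eb /set_mem //]; first exact: beta2_setT.
move=> /beta2P[->|[A1 I1 ->]]; first by rewrite setTI.
move=> /beta2P[->|[A2 I2 ->]]; first by rewrite setIT; exact: beta2_setC.
by rewrite -setCU -preimage_setU; apply/beta2_setC/IU.
Qed.

(** A basic neighbourhood, disjoint from S', of a point outside S' cannot be
    all of S because S' is nonempty; its complement is therefore a member of
    the family that separates the point from S'. *)
Lemma basis_closed_IntAut S' : is_basis (tau2 T S B) (beta2 T S B) ->
    B `<=` S' -> S' `<=` S -> S' !=set0 ->
    is_closed (tau2 T S B) (val @^-1` S') ->
  IntAut T S B S'.
Proof.
move=> bb BS' S'S [y S'y] clS'; apply: IntAut_separated => // x Sx S'x.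
rewrite is_closedE in clS'.
have [U [bU Ux US']] := is_basis_open (x := SigSub (mem_set Sx)) bb clS' S'x.
have {bU}[UT|[A IA UA]] := beta2P bU.
  by have := US' (SigSub (mem_set (S'S _ S'y))); rewrite UT => /(_ I) /(_ S'y).
rewrite UA in Ux US'; exists A; split=> // z S'z; apply: contrapT => nAz.
exact: (US' (SigSub (mem_set (S'S _ S'z)))).
Qed.

(** * Topologies in P2 *)

(** The condition defining P2 constrains the nonempty members only; the empty
    set is closed in any topology. *)
Lemma P2_closed t A :
  P2 T S B t -> IntAut T S B A -> is_closed t (val @^-1` A).
Proof.
move=> Pt IA; have [->|A0] := eqVneq A set0.
  by rewrite preimage_set0; exact: (@closed0 (Topological.Pack t)).
have : (IntAut T S B `\ set0) A by split=> //; exact/eqP.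
by rewrite Pt => -[].
Qed.

Lemma P2_sub_Q2 : P2 T S B `<=` Q2 T S B.
Proof. by move=> t Pt; apply: closed_IntAut_finer => A; exact: P2_closed. Qed.

(** The case of an empty S1 is separate because the condition defining P2 says nothing
    about whether an empty union is a member. *)
Lemma P2_IntAutU t S1 S2 : operator_semigroup T -> Tspace T S -> P2 T S B t ->
  IntAut T S B S1 -> IntAut T S B S2 -> IntAut T S B (S1 `|` S2).
Proof.
move=> sgT TS Pt I1 I2.
have [->|/set0P[a S1a]] := eqVneq S1 set0; first by rewrite set0U.
suff : (IntAut T S B `\ set0) (S1 `|` S2) by case.
have [BS1 _] := IntAut_between I1.
have sub A (IA : IntAut T S B A) : A \in Sub_pred T S.
  by apply/asboolP; exact: IntAut_sub IA.
rewrite Pt; split.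
- by move=> x /BS1; left.
- by apply/asboolP; exact: Sub_predU (sub _ I1) (sub _ I2).
- by rewrite preimage_setU; apply: is_closedU; exact: P2_closed.
- by exists a; left.
Qed.

Lemma basis_P2 : operator_semigroup T -> Tspace T S ->
  is_basis (tau2 T S B) (beta2 T S B) -> P2 T S B (tau2 T S B).
Proof.
move=> sgT TS bb; apply/seteqP; split=> [A [IA /eqP/set0P A0]|A].
  split=> //; [by case: (IntAut_between IA) | exact: IntAut_sub IA |].
  by rewrite is_closedE; apply/beta2_tau2/beta2_setC.
move=> [BA [_ _ AS] clA A0]; split; first exact: basis_closed_IntAut.
by apply/eqP/set0P.
Qed.

End IntAutTopologies.

Theorem theorem5p2p2 (D : Type) (T : set (D -> D)) (S B : set D)
    (T_semigroup : operator_semigroup T) (S_Tspace : Tspace T S)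
    (BS : B `<=` S) :
  P2 T S B `<=` Q2 T S B /\
  [<-> (* i *)    P2 T S B !=set0;
       (* ii *)   forall S1 S2, IntAut T S B S1 -> IntAut T S B S2 ->
                    IntAut T S B (S1 `|` S2);
       (* ii' *)  is_basis (tau2 T S B) (beta2 T S B);
       (* iii *)  join_sublattice (Int_in_Sub T S B);
       (* iv *)   P2 T S B (tau2 T S B);
       (* iv' *)  P2 T S B (tau2 T S B) /\
                    forall t, P2 T S B t -> finer t (tau2 T S B)].
Proof.
split; first exact: P2_sub_Q2.
have latticeP := IntAutU_lattice B T_semigroup S_Tspace.
tfae.
- by move=> [t Pt] S1 S2; exact: P2_IntAutU Pt.
- exact: IntAutU_basis.
- move=> bb; apply/latticeP => S1 S2.
  by apply: P2_IntAutU => //; exact: basis_P2.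
- by move=> /latticeP IU; apply: basis_P2 => //; exact: IntAutU_basis.
- by move=> Pt; split=> // t; exact: P2_sub_Q2.
- by move=> [Pt _]; exists (tau2 T S B).
Qed.
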